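(* Let $k\geq 1$, let $X = \mathrm{diag}(x_1,\ldots,x_k)$ be a $k \times k$ complex diagonal matrix, and let $\delta_-(X)$ be the $k\times k$ matrix with $(i,j)$ entry $x_i - x_j$. Then for every partition $\lambda \vdash k$, \[ \mathrm{Imm}^{\lambda}(\delta_-(X)) = \begin{cases} (-1)^{\lambda_2} \sum_{l=0}^k (-1)^l (k-l)!\, l!\, \mathsf{e}_{k-l}(X)\, \mathsf{e}_l(X) & \text{if } \ell(\lambda) \leq 2, \\ 0 & \text{otherwise,} \end{cases} \] where $\lambda_2 = 0$ if $\ell(\lambda)=1$.
   Context: For $\lambda \vdash k$ and a $k\times k$ matrix $Y=(y_{ij})$, the immanant is $\mathrm{Imm}^\lambda(Y) = \sum_{\sigma \in S_k} \chi^\lambda(\sigma) \prod_{i=1}^k y_{i\sigma(i)}$, where $\chi^\lambda$ is the character of the irreducible representation of $S_k$ labeled by $\lambda$. $\ell(\lambda)$ is the number of parts of $\lambda$. $\mathsf{e}_l(X)$ is the $l$-th elementary symmetric polynomial in $x_1,\ldots,x_k$ ($\mathsf{e}_0=1$). *)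

(* Defs.v *)
From HB Require Import structures.
From mathcomp Require Import all_boot all_order all_algebra all_fingroup.
From mathcomp Require Import mxrepresentation.
From mathcomp Require Import mpoly.

Set Implicit Arguments.
Unset Strict Implicit.
Unset Printing Implicit Defensive.

Import GRing.Theory.
Local Open Scope ring_scope.

(* Partitions of k, as weakly decreasing sequences of positive parts.  With
   this encoding the number of parts is [size la], and the 1-based part la_j
   (0 when j exceeds the number of parts) is [nth 0 la j.-1]. *)
Definition is_partition_of (k : nat) (la : seq nat) : bool :=
  [&& sorted geq la, 0 \notin la & sumn la == k]%N.

Section Specht.

Variables (F : fieldType) (k : nat) (la : seq nat).

(* The rows and columns are those of the tableau of shape la filled with
   0, 1, ..., k-1 row by row: i sits in row [reshape_index la i] and column
   [reshape_offset la i]. *)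
Definition row_stabilizer : {set 'S_k} :=
  [set s : 'S_k | [forall i : 'I_k, reshape_index la (s i) == reshape_index la i]].

Definition col_stabilizer : {set 'S_k} :=
  [set s : 'S_k | [forall i : 'I_k, reshape_offset la (s i) == reshape_offset la i]].

(* The group algebra F[S_k] is modelled by its regular representation, which
   acts by right multiplication on row vectors.  Since [q * p] is "q then p",
   this is the classical Young symmetrizer
   (sum of the row permutations) o (signed sum of the column permutations). *)
Definition young_symmetrizer : 'M[F]_#|[set: 'S_k]%G| :=
  \sum_(q in col_stabilizer) \sum_(p in row_stabilizer)
    (-1) ^+ q *: regular_repr F [set: 'S_k]%G (q * p)%g.

(* The Specht module, i.e. the ideal of F[S_k] generated by the Young
   symmetrizer; it is a right ideal here because of the order in which
   permutations are multiplied, and a left ideal for the usual composition. *)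
Definition specht_module : 'M[F]_#|[set: 'S_k]%G| :=
  cyclic_mx (regular_repr F [set: 'S_k]%G)
    (gring_row young_symmetrizer).

Definition specht_repr :
    mx_representation F [set: 'S_k]%G (\rank specht_module) :=
  submod_repr
    (cyclic_mx_module (regular_repr F [set: 'S_k]%G)
       (gring_row young_symmetrizer)).

Definition specht_char (s : 'S_k) : F := \tr (specht_repr s).

Definition immanant (Y : 'M[F]_k) : F :=
  \sum_(s : 'S_k) specht_char s * \prod_(i < k) Y i (s i).

End Specht.

Definition delta_minus (F : fieldType) (k : nat) (X : 'M[F]_k) : 'M[F]_k :=
  \matrix_(i, j) (X i i - X j j).

Definition elem_sym (F : fieldType) (k l : nat) (X : 'M[F]_k) : F :=
  (mesym k F l).@[fun i => X i i].

(* Main.v *)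
Require Import Defs.
From mathcomp Require Import all_boot all_order all_algebra all_fingroup.
From mathcomp Require Import mpoly mxrepresentation zify.
From mathcomp Require Import complex reals.
Set Implicit Arguments.
Unset Strict Implicit.
Unset Printing Implicit Defensive.
Import Order.TTheory GRing.Theory Num.Theory.
Local Open Scope ring_scope.

(** For a class function [f], the polynomial
    [\sum_s f s * \prod_i ('X_i - 'X_(s i))] is symmetric, homogeneous of degree
    [k], of degree at most 2 in each variable, and killed by the derivation
    [\sum_i d/dX_i].  These properties determine it up to a scalar: the derivation
    relates the coefficient of a monomial to those with one square less, down to
    the coefficient of [X_1...X_k].  That coefficient is
    [\sum_s f s * \sum_(T | s @: T = T) (-1)^|T|], an alternating sum of the
    pairings of [f] with the permutation characters on [l]-subsets.  For a shape
    with rows [a >= m], these pairings are 1 for [m <= l <= a] and 0 otherwise,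
    because the Young symmetrizer acts on functions of [l]-subsets with rank at
    most one.  Hence the immanant is [(-1)^m] times the permanent, which a direct
    expansion evaluates.

    If the first column has at least three boxes, expand each factor
    [x_i - x_(s i)]: two boxes of that column make the same choice, so exchanging
    them cancels the signed sum over the column stabilizer. *)

(** * Exchanges of elements and sums over subsets *)

Section Swap.
Variable (I : finType).
Implicit Types (A B : {set I}) (x y : I).

Lemma in_imset_perm (s : {perm I}) A x : (x \in s @: A) = ((s^-1)%g x \in A).
Proof. by rewrite -{1}(permKV s x) mem_imset //; exact: perm_inj. Qed.

Lemma card_imset_perm (s : {perm I}) A : #|s @: A| = #|A|.
Proof. by rewrite card_imset //; exact: perm_inj. Qed.

Lemma imset_permM (s t : {perm I}) A : (s * t)%g @: A = t @: (s @: A).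
Proof. by apply/setP => x; rewrite !in_imset_perm invMg permM. Qed.

Lemma imset_perm1 A : (1 : {perm I})%g @: A = A.
Proof. by apply/setP => x; rewrite in_imset_perm invg1 perm1. Qed.

Lemma in_imset_tperm x y A z : (z \in tperm x y @: A) = (tperm x y z \in A).
Proof. by rewrite in_imset_perm tpermV. Qed.

Lemma eq_card_setDn0 A B : #|A| = #|B| -> A != B -> exists x, x \in A :\: B.
Proof.
move=> c nAB; apply/set0Pn; apply: contra_neq nAB => /eqP; rewrite setD_eq0 => sAB.
by apply/eqP; rewrite eqEcard sAB c leqnn.
Qed.

(** Induction on [#|A :\: B|]: exchanging [x] with [y] removes [x] from this difference and adds
    nothing. The step is free to choose the pair. *)
Lemma swap_ind B (P : {set I} -> Prop) : P B ->
    (forall A, #|A| = #|B| -> A != B ->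
       exists x y, [/\ x \in A :\: B, y \in B :\: A
                     & P (tperm x y @: A) -> P A]) ->
  forall A, #|A| = #|B| -> P A.
Proof.
move=> PB step A; move En: #|A :\: B| => n.
elim: n A En => [|n IH] A En cAB.
  have sAB : A \subset B by rewrite -setD_eq0 -cards_eq0 En.
  by have -> : A = B by apply/eqP; rewrite eqEcard sAB cAB leqnn.
have nAB : A != B by apply: contra_eq_neq En => ->; rewrite setDv cards0.
have [x [y [/setDP[xA xB] /setDP[yB yA] PA]]] := step A cAB nAB.
apply/PA/IH; last by rewrite card_imset_perm.
suff -> : tperm x y @: A :\: B = (A :\: B) :\ x.
  by apply/eqP; rewrite -(@eqn_add2l 1) [X in _ == X]add1n -En (cardsD1 x (A :\: B)) !inE xA xB.
apply/setP => z; rewrite !inE in_imset_tperm.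
case: tpermP => [->|->|].
- by rewrite (negPf yA) andbF eqxx.
- by rewrite yB !andbF.
- by move=> /eqP-> _.
Qed.

Lemma swap_invariant_card (X : Type) (f : {set I} -> X) :
    (forall x y A, f (tperm x y @: A) = f A) ->
  forall A B, #|A| = #|B| -> f A = f B.
Proof.
move=> fT A B; apply: (swap_ind (P := fun A => f A = f B)) => // {}A cAB nAB.
have [x xA] := eq_card_setDn0 cAB nAB.
have [y yB] : exists y, y \in B :\: A by apply: eq_card_setDn0; rewrite 1?eq_sym.
by exists x, y; split => //; rewrite fT.
Qed.
End Swap.

Section SetSums.
Variable n : nat.
Implicit Types A B : {set 'I_n}.

Lemma max_card_ord A : (#|A| <= n)%N.
Proof. by have := max_card A; rewrite card_ord. Qed.

(** Composing with a transposition shows that the count is the same for all [B] of size [#|A|];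
    these ['C(n, #|A|)] equal counts add up to [n!]. *)
Lemma sum_perm_imset A B :
  (\sum_(s : 'S_n) (s @: A == B) = (#|B| == #|A|) * ((n - #|A|)`! * #|A|`!))%N.
Proof.
pose N (B : {set 'I_n}) := (\sum_(s : 'S_n) (s @: A == B))%N.
have [cBA|cBA] := eqVneq #|B| #|A|; last first.
  rewrite mul0n big1 // => s _; case: eqP => // e.
  by rewrite -e card_imset_perm eqxx in cBA.
have NT y z (D : {set 'I_n}) : N (tperm y z @: D) = N D.
  rewrite /N (reindex_inj (mulIg (tperm y z))) /=; apply: eq_bigr => s _.
  by rewrite imset_permM (inj_eq (imset_inj (@perm_inj _ _))).
have : (\sum_(D : {set 'I_n} | #|D| == #|A|) N D = 'C(n, #|A|) * N B)%N.
  rewrite (eq_bigr (fun=> N B)) => [|D /eqP cD]; last first.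
    by apply: swap_invariant_card; rewrite ?cD.
  rewrite sum_nat_const; congr (_ * _)%N.
  rewrite -[X in 'C(X, _)](card_ord n) -card_draws.
  by apply: eq_card => D; rewrite !inE.
rewrite exchange_big /= (eq_bigr (fun=> 1%N)) => [|s _]; last first.
  rewrite (bigD1 (s @: A)) ?card_imset_perm //= eqxx big1 // => D /andP[_].
  by rewrite eq_sym => /negPf->.
rewrite sum1_card card_Sn -(bin_fact (max_card_ord A)) => /eqP.
rewrite eqn_pmul2l ?bin_gt0 ?max_card_ord // => /eqP e.
by rewrite -[LHS]e mul1n mulnC.
Qed.

Lemma big_set_card (F : nmodType) (f : {set 'I_n} -> F) :
  \sum_A f A = \sum_(l < n.+1) \sum_(A : {set 'I_n} | #|A| == l) f A.
Proof.
rewrite (partition_big (fun A : {set 'I_n} => inord #|A| : 'I_n.+1) xpredT) //=.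
apply: eq_bigr => l _; apply: eq_bigl => A.
by rewrite -val_eqE /= inordK // ltnS max_card_ord.
Qed.
End SetSums.

(** * The permanent of the matrix of differences *)

Section Permanent.
Variables (F : numFieldType) (n : nat) (x : 'I_n -> F).

Definition sum_sym (l : nat) : F := \sum_(A : {set 'I_n} | #|A| == l) \prod_(i in A) x i.

Lemma sum_perm_prod (A : {set 'I_n}) :
  \sum_(s : 'S_n) \prod_(i in A) x (s i) =
    (n - #|A|)`!%:R * #|A|`!%:R * sum_sym #|A|.
Proof.
transitivity (\sum_(s : 'S_n) \sum_B (s @: A == B)%:R * \prod_(i in B) x i).
  apply: eq_bigr => s _; rewrite (bigD1 (s @: A)) //= eqxx mul1r.
  rewrite [X in _ = _ + X]big1 ?addr0 => [|B]; last by rewrite eq_sym => /negPf->; rewrite mul0r.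
  by rewrite big_imset //= => i j _ _; apply: perm_inj.
rewrite exchange_big /= /sum_sym mulr_sumr [RHS]big_mkcond; apply: eq_bigr => B _.
rewrite -mulr_suml -natr_sum sum_perm_imset natrM.
by case: ifP => _; rewrite ?mul0r // mul1r natrM.
Qed.

Lemma permanent_delta :
  \sum_(s : 'S_n) \prod_(i < n) (x i - x (s i)) =
  \sum_(0 <= l < n.+1)
     (-1) ^+ l * ((n - l)`!)%:R * (l`!)%:R * sum_sym (n - l) * sum_sym l.
Proof.
under eq_bigr => s _ do rewrite bigA_distr.
rewrite exchange_big /=.
(* After passing to complements, [J] is the set of indices whose factor contributes [- x (s i)]. *)
transitivity (\sum_(J : {set 'I_n}) (\prod_(i in ~: J) x i) *
    ((-1) ^+ #|J| * (((n - #|J|)`!)%:R * (#|J|`!)%:R * sum_sym #|J|))).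
  rewrite (reindex_inj (@setC_inj _)) /=; apply: eq_bigr => J _.
  rewrite -sum_perm_prod mulrA mulr_sumr.
  apply: eq_bigr => s _.
  rewrite (bigID (mem J)) /= mulrC -mulrA; congr (_ * _).
    by apply: eq_big => i; rewrite inE // => ->.
  rewrite -prodrN; apply: eq_bigr => i iJ; by rewrite inE iJ.
rewrite big_mkord big_set_card; apply: eq_bigr => l _.
rewrite (eq_bigr (fun J : {set 'I_n} => (\prod_(i in ~: J) x i) *
    ((-1) ^+ l * (((n - l)`!)%:R * (l`!)%:R * sum_sym l)))) => [|J /eqP-> //].
rewrite -mulr_suml mulrC; rewrite -!mulrA; do 3 congr (_ * _).
rewrite mulrC; congr (_ * _).
rewrite /sum_sym (reindex_inj (@setC_inj _)) /=; apply: eq_big => [J|J _]; last by rewrite setCK.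
rewrite cardsCs setCK card_ord.
apply/eqP/eqP => [<-|->]; first by rewrite subKn // max_card_ord.
by rewrite subKn // leq_ord.
Qed.
End Permanent.

(** * Symmetric polynomials quadratic in each variable *)

Section SymmetricQuadratic.
Variables (F : numFieldType) (n : nat).
Implicit Types (G : {mpoly F[n]}) (m : 'X_{1..n}).

(** Induction on the number of exponents equal to 2; when there are none, degree [n] forces every
    exponent to be 1. *)
Lemma symmetric_quadratic_eq0 G :
    G \is symmetric -> \sum_(i < n) mderiv i G = 0 ->
    (forall m, G@_m != 0 -> (forall i, m i <= 2)%N /\ mdeg m = n) ->
    G@_[multinom 1 | _ < n] = 0 -> G = 0.
Proof.
move=> symG dG0 supG G1.
apply/mpolyP=> m; rewrite mcoeff0.
move Eu: #|[pred i | m i == 2%N]| => u.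
elim: u m Eu => [|u IH] m Eu.
  apply/eqP/negPn/negP => nz; have [le2 dm] := supG _ nz.
  have le1 i : (m i <= 1)%N.
    have := le2 i; rewrite leq_eqVlt ltnS => /orP[/eqP mi|//].
    by have := card0_eq Eu i; rewrite !inE mi.
  case/negP: nz; suff -> : m = [multinom 1 | _ < n] by rewrite G1.
  apply/mnmP=> i; rewrite mnmE.
  have: (\sum_(j < n) (1 - m j) == 0)%N.
    have e : (\sum_(j < n) (1 - m j) + \sum_(j < n) m j = n)%N.
      rewrite -big_split /= (eq_bigr (fun=> 1%N)) ?sum1_card ?card_ord // => j _.
      by rewrite subnK.
    by move: e; rewrite -mdegE dm => /eqP; rewrite -[X in _ == X]add0n eqn_add2r.
  rewrite sum_nat_eq0 => /forallP/(_ i)/=; rewrite subn_eq0 => ge1.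
  by apply/eqP; rewrite eqn_leq le1.
have [i0 /eqP mi0] : exists i0, m i0 == 2%N.
  by case/card_gt0P: (eq_ind_r (fun v => 0 < v)%N (ltn0Sn u) Eu) => i; rewrite inE; exists i.
pose m' := (m - U_(i0))%MM.
have m'E j : m' j = (m j - (i0 == j))%N by rewrite /m' mnmBE mnm1E.
have m'i0 : m' i0 = 1%N by rewrite m'E mi0 eqxx.
have mE : (m' + U_(i0))%MM = m.
  by apply/mnmP => j; rewrite mnmDE m'E mnm1E subnK //; case: eqP => // <-; rewrite mi0.
have := congr1 (mcoeff m') dG0; rewrite mcoeff0 raddf_sum /=.
(* By symmetry each [j] of exponent 1 in [m'] gives [2 * G@_m]. Exponent 0 gives a monomial with one
   square less, zero by induction; exponent 2 would give a cube, which [supG] excludes. *)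
have -> : \sum_(j < n) (mderiv j G)@_m' = G@_m *+ (2 * #|[pred j | m' j == 1%N]|).
  rewrite mulnC mulrnA -sumr_const [X in _ = X *+ _]big_mkcond /= -sumrMnl; apply: eq_bigr => j _.
  rewrite mcoeff_deriv inE; case: eqP => [m'j|/eqP m'j].
    rewrite m'j; congr (_ *+ _).
    suff -> : (m' + U_(j))%MM = [multinom m (tperm i0 j i) | i < n].
      by rewrite -mcoeff_sym (issymP _ symG).
    apply/mnmP => i; rewrite mnmE mnmDE mnm1E -mE mnmDE mnm1E.
    case: tpermP => [->|->|].
    - by rewrite m'i0 m'j eq_sym.
    - by rewrite m'i0 m'j !eqxx.
    - by move=> /eqP n1 /eqP n2; rewrite [j == _]eq_sym [i0 == _]eq_sym (negPf n1) (negPf n2).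
  rewrite mul0rn; have [m'j0|m'j0] := posnP (m' j).
    rewrite IH ?mul0rn //; apply/eqP.
    rewrite -(@eqn_add2l 1) [X in _ == X]add1n -Eu [X in _ == X](cardD1 i0) inE mi0.
    apply/eqP; congr (_ + _)%N; apply: eq_card => i.
    rewrite !inE mnmDE mnm1E -mE mnmDE mnm1E.
    have [->|ni] := eqVneq i i0; last first.
      rewrite addn0 //=.
      by have [<-|] := eqVneq j i; rewrite ?m'j0 ?addn0.
    rewrite m'i0; have [ej|] := eqVneq j i0; last by rewrite addn0.
    by move: m'j0; rewrite ej m'i0.
  have [/eqP->|nz] := boolP (G@_(m' + U_(j)) == 0); first by rewrite mul0rn.
  have [/(_ j)] := supG _ nz; rewrite mnmDE mnm1E eqxx addn1.
  by case: (m' j) m'j m'j0 => [|[|]].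
move/eqP; rewrite mulrn_eq0 => /orP[|/eqP//].
rewrite muln_eq0 /= => /eqP /card0_eq/(_ i0).
by rewrite !inE m'i0.
Qed.
End SymmetricQuadratic.

(** * Expansion of the products of differences attached to permutations *)

Section DeltaProducts.
Variables (F : numFieldType) (n : nat).
Implicit Types (s t : 'S_n) (J : {set 'I_n}).

Definition delta_prod s : {mpoly F[n]} := \prod_(i < n) ('X_i - 'X_(s i)).

Definition delta_mon s J : 'X_{1..n} :=
  (\sum_(i < n) U_(if i \in J then i else s i))%MM.

(** The variable of index [j] comes from the factor at [j] when [j] is in [J], and from the factor
    at [(s^-1)%g j] when that index is outside [J]. *)
Lemma delta_monE s J j :
  delta_mon s J j = ((j \in J) + ((s^-1)%g j \notin J))%N.
Proof.
rewrite mnm_sumE (eq_bigr (fun i => (if i \in J then i == j else s i == j) : nat)).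
  rewrite (bigID (mem J)) /=; congr (_ + _)%N.
    rewrite (eq_bigr (fun i => (i == j) : nat)) => [|i ->//].
    rewrite -big_mkcondr /= sum1dep_card; case jJ: (j \in J) => /=.
      rewrite -(cards1 j); apply: eq_card => i; rewrite !inE.
      by case: eqP => [->|]; rewrite ?jJ ?andbF.
    by apply: eq_card0 => i; rewrite !inE; case: eqP => [->|]; rewrite ?jJ ?andbF.
  rewrite (eq_bigr (fun i => (i == (s^-1)%g j) : nat)) => [|i /negPf->]; last first.
    by rewrite -(inj_eq (@perm_inj _ s) i) permKV.
  rewrite -big_mkcondr /= sum1dep_card; case jJ: (_ \in J) => /=.
    by apply: eq_card0 => i; rewrite !inE; case: eqP => [->|]; rewrite ?jJ ?andbF.
  rewrite -(cards1 ((s^-1)%g j)); apply: eq_card => i; rewrite !inE.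
  by case: eqP => [->|]; rewrite ?jJ ?andbF.
by move=> i _; rewrite mnm1E; case: ifP.
Qed.

Lemma delta_prodE s :
  delta_prod s = \sum_(J : {set 'I_n}) (-1) ^+ #|~: J| *: 'X_[delta_mon s J].
Proof.
rewrite /delta_prod bigA_distr; apply: eq_bigr => J _.
rewrite (eq_bigr (fun i => (if i \notin J then -1 else 1) *
   ('X_[U_(if i \in J then i else s i)] : {mpoly F[n]}))); last first.
  by move=> i _; case: ifP => _ /=; rewrite ?mul1r // mulN1r.
rewrite big_split /= -big_mkcond /= (eq_bigl (mem (~: J))) => [|i]; last by rewrite !inE.
rewrite prodr_const -mul_mpolyC rmorphXn rmorphN rmorph1; congr (_ * _).
by rewrite /delta_mon (big_morph (fun m => 'X_[m]) (@mpolyXD n F) (mpolyX0 _ _)).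
Qed.

Lemma mdeg_delta_mon s J : mdeg (delta_mon s J) = n.
Proof.
rewrite mdeg_sum (eq_bigr (fun=> 1%N)) ?sum1_card ?card_ord // => i _.
by rewrite mdeg1.
Qed.

Definition fixed_sets_sign s : F :=
  \sum_(T : {set 'I_n} | s @: T == T) (-1) ^+ #|T|.

(** All exponents are 1 exactly when [J] is stable under [s]; its complement [T], where the negative
    terms are taken, is then stable too and gives the sign. *)
Lemma delta_prod_coef1 s :
  (delta_prod s)@_[multinom 1 | _ < n] = fixed_sets_sign s.
Proof.
rewrite delta_prodE raddf_sum /= /fixed_sets_sign (reindex_inj (@setC_inj _)) /=.
rewrite [RHS]big_mkcond; apply: eq_bigr => T _.
rewrite mcoeffZ mcoeffX setCK.
suff -> : (delta_mon s (~: T) == [multinom 1 | _ < n]) = (s @: T == T).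
  by case: ifP => _; rewrite ?mulr1 ?mulr0.
apply/eqP/eqP => [e|e].
  apply/setP => x; rewrite in_imset_perm.
  move/mnmP/(_ x): e; rewrite delta_monE mnmE !inE negbK.
  by case: (_ \in T); case: (_ \in T).
apply/mnmP => x; rewrite delta_monE mnmE !inE negbK.
by rewrite -{1}e in_imset_perm; case: (_ \in T).
Qed.

Lemma class_function_immanant_eq0 (f : 'S_n -> F) :
    (forall s t, f (s ^ t)%g = f s) ->
    \sum_s f s * fixed_sets_sign s = 0 ->
  \sum_s f s *: delta_prod s = 0.
Proof.
move=> fJ fs0; apply: symmetric_quadratic_eq0.
(* Renaming the variables by [t] conjugates [s], and [f] is a class function. *)
- apply/issymP => t; rewrite raddf_sum /=.
  rewrite [RHS](reindex_inj (@conjg_inj _ t)) /=; apply: eq_bigr => s _.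
  rewrite msymZ fJ; congr (_ *: _).
  have msymXi i : msym t 'X_i = 'X_(t i) :> {mpoly F[n]}.
    rewrite msymX; congr 'X_[_]; apply/mnmP => j; rewrite mnmE !mnm1E.
    by rewrite -(inj_eq (@perm_inj _ t)) permKV.
  rewrite /delta_prod rmorph_prod /= [RHS](reindex_inj (@perm_inj _ t)) /=.
  apply: eq_bigr => i _; rewrite msymB !msymXi; congr (_ - 'X_ _).
  by rewrite conjgE !permM permK.
- under eq_bigr => i _ do rewrite raddf_sum.
  rewrite exchange_big /= big1 // => s _.
  under eq_bigr => i _ do rewrite mderivZ.
  rewrite -scaler_sumr; apply/eqP; rewrite scaler_eq0; apply/orP; right; apply/eqP.
  (* The kernel of the derivation is closed under products and contains all differences of
     variables. *)
  apply: (big_ind (fun p : {mpoly F[n]} => \sum_(i < n) mderiv i p = 0)).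
  - by rewrite big1 // => i _; rewrite -mpolyC1 mderivC.
  - move=> p q p0 q0; under eq_bigr => i _ do rewrite mderivM.
    by rewrite big_split /= -mulr_sumr q0 mulr0 addr0 -mulr_suml p0 mul0r.
  move=> j _; under eq_bigr => i _ do rewrite mderivB.
  have d1 (l : 'I_n) : \sum_(i < n) mderiv i 'X_l = 1 :> {mpoly F[n]}.
    rewrite (bigD1 l) //= big1 ?addr0 => [|i il]; rewrite mderivX mnm1E.
      rewrite eqxx scale1r -mpolyX0; congr (mpolyX _ _).
      by apply/mnmP => j1; rewrite mnmBE subnn mnm0E.
    by rewrite eq_sym (negPf il) scale0r.
  by rewrite sumrB !d1 subrr.
- move=> m nz.
  have [s [J ->]] : exists s J, m = delta_mon s J.
    case: (boolP [exists s, exists J, m == delta_mon s J]) => [|nex].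
      by move=> /existsP[s /existsP[J /eqP ->]]; exists s, J.
    case/eqP: nz; rewrite raddf_sum /= big1 // => s _.
    rewrite mcoeffZ delta_prodE raddf_sum /= big1 ?mulr0 // => J _.
    rewrite mcoeffZ mcoeffX; case: eqP => [e|]; last by rewrite mulr0.
    by case/existsP: nex; exists s; apply/existsP; exists J; rewrite e.
  split; last exact: mdeg_delta_mon.
  by move=> i; rewrite delta_monE; case: (_ \in J); case: (_ \in J).
- rewrite raddf_sum /= -[RHS]fs0; apply: eq_bigr => s _.
  by rewrite mcoeffZ delta_prod_coef1.
Qed.
End DeltaProducts.

(** * Traces on right ideals of a group algebra *)

Section SubmodTrace.
Variables (F : fieldType) (gT : finGroupType) (G : {group gT}) (n : nat).
Variables (rG : mx_representation F G n) (U : 'M[F]_n) (Umod : mxmodule rG U).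

Lemma mxtrace_submod_quasi_idempotent (L : 'M[F]_n) (c : F) :
    (L :=: U)%MS -> L *m L = c *: L ->
  forall x, x \in G -> c * \tr (submod_repr Umod x) = \tr (L *m rG x).
Proof.
(* If [L = K B] with [B] a basis of [U], then [B L = c B] forces [B K = c]. *)
move=> LU LL x Gx; pose B := val_submod (U := U) 1%:M; pose K := in_submod U L.
have KB : K *m B = L by rewrite -val_submodE in_submodK // LU.
have [M BM] : exists M, B = M *m L by apply/submxP; rewrite LU val_submod1.
have BL : B *m L = c *: B by rewrite BM -mulmxA LL scalemxAr.
have BK : B *m K = c%:M.
  apply: (@val_submod_inj _ _ U); rewrite val_submodE -/B -mulmxA KB BL.
  by rewrite (val_submodE c%:M) -/B mul_scalar_mx.
have SB : submod_repr Umod x *m B = B *m rG x.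
  by rewrite -val_submodJ // mul1mx val_submodE.
rewrite -KB -(mulmxA K) -SB (mulmxA K) [RHS]mxtrace_mulC (mulmxA B K) BK.
by rewrite mul_scalar_mx mxtraceZ.
Qed.

(** A basis of [U] intertwines the restricted action with [rG], so the weighted sum restricts to the
    zero matrix. *)
Lemma mxtrace_submod_sum_eq0 (f : gT -> F) :
    U *m (\sum_(x in G) f x *: rG x) = 0 ->
  \sum_(x in G) f x * \tr (submod_repr Umod x) = 0.
Proof.
move=> UW0; pose B := val_submod (U := U) 1%:M.
suff S0 : \sum_(x in G) f x *: submod_repr Umod x = 0.
  rewrite (eq_bigr (fun x => \tr (f x *: submod_repr Umod x))) => [|x _].
    by rewrite -raddf_sum S0 /= mxtrace0.
  by rewrite mxtraceZ.
apply: (@val_submod_inj _ _ U); rewrite linear0 linear_sum /=.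
have [M BM] : exists M, B = M *m U by apply/submxP; rewrite val_submod1.
transitivity (B *m (\sum_(x in G) f x *: rG x)); last by rewrite BM -mulmxA UW0 mulmx0.
rewrite mulmx_sumr; apply: eq_bigr => x Gx.
by rewrite linearZ -scalemxAr /= -[submod_mx _ _]mul1mx val_submodJ.
Qed.
End SubmodTrace.

(** * The regular representation in terms of functions on the group *)

Section Convolution.
Variables (F : fieldType) (gT : finGroupType).
Local Notation G := [set: gT]%G.
Local Notation aG := (regular_repr F G).

Definition row_of_fun (f : gT -> F) : 'rV[F]_#|G| := \row_j f (enum_val j).

Lemma row_of_funJ f x :
  row_of_fun f *m aG x = row_of_fun (fun y => f (y * x^-1)%g).
Proof.
apply/rowP => j; rewrite !mxE (bigD1 (gring_index G (enum_val j * x^-1))) //=.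
rewrite !mxE gring_indexK ?inE // mulgKV gring_valK !eqxx mulr1 big1 ?addr0 // => i ij.
rewrite !mxE eqxx /= [j == _]eq_sym; case: eqP => [e|_]; last by rewrite mulr0.
case/eqP: ij; rewrite -e gring_indexK ?inE // mulgK; exact/esym/gring_valK.
Qed.

Lemma gring_row_regular g : gring_row (aG g) = row_of_fun (fun y => (g == y)%:R).
Proof.
apply/rowP => j; rewrite !mxE gring_indexK ?inE // mul1g.
by rewrite -{1}(gring_valK j) (can_in_eq (@gring_indexK _ G)) ?inE // eq_sym.
Qed.

(* Left multiplication by [f] in the group algebra, acting on row vectors. *)
Definition lmul_mx (f : gT -> F) : 'M[F]_#|G| :=
  \matrix_(i, j) f (enum_val j * (enum_val i)^-1)%g.

(** The rows of [lmul_mx f] are the right translates of [f], which span the cyclic module. *)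
Lemma cyclic_mx_lmul f : (lmul_mx f :=: cyclic_mx aG (row_of_fun f))%MS.
Proof.
suff -> : cyclic_mx aG (row_of_fun f) = <<lmul_mx f>>%MS.
  exact/eqmx_sym/genmxE.
congr (<<_>>%MS); apply/row_matrixP => i.
rewrite row_mul mul_rV_lin1 /= rowK mxvecK row_of_funJ.
by apply/rowP => j; rewrite !mxE.
Qed.

Lemma big_enum_group (h : gT -> F) : \sum_(i < #|G|) h (enum_val i) = \sum_g h g.
Proof. by rewrite -big_enum_val; apply: eq_bigl => g; rewrite inE. Qed.

Lemma lmul_mx_sqr f c :
    (forall g, \sum_h f h * f (h^-1 * g)%g = c * f g) ->
  lmul_mx f *m lmul_mx f = c *: lmul_mx f.
Proof.
move=> ff; apply/matrixP => i j; rewrite !mxE -ff.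
under eq_bigr => l _ do rewrite !mxE.
rewrite (big_enum_group (fun g => f (g * (enum_val i)^-1)%g * f (enum_val j * g^-1)%g)).
rewrite (reindex_inj (inj_comp (mulIg (enum_val j)) invg_inj)) /=.
by apply: eq_bigr => h _; rewrite mulrC invMg invgK mulKVg mulgA.
Qed.

Lemma mxtrace_lmul_regular f g :
  \tr (lmul_mx f *m aG g) = \sum_h f (h * g^-1 * h^-1)%g.
Proof.
rewrite -(big_enum_group (fun h => f (h * g^-1 * h^-1)%g)); apply: eq_bigr => i _.
have := congr1 (fun u : 'rV_ _ => u 0 i) (row_of_funJ (fun y => f (y * (enum_val i)^-1)%g) g).
rewrite !mxE => <-; apply: eq_bigr => j _; rewrite !mxE //.
Qed.
End Convolution.

(** * Specht characters and immanants through the Young symmetrizer *)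

Section SpechtTrace.
Variables (F : fieldType) (k : nat) (la : seq nat).
Local Notation C := (col_stabilizer k la).
Local Notation R := (row_stabilizer k la).

(** The coefficients of the Young symmetrizer as an element of the group algebra. *)
Definition young_coef (g : 'S_k) : F :=
  \sum_(q in C) \sum_(p in R) (-1) ^+ q * (q * p == g)%g%:R.

Lemma gring_row_young : gring_row (young_symmetrizer F k la) = row_of_fun young_coef.
Proof.
rewrite /young_symmetrizer linear_sum /=; apply/rowP => j; rewrite summxE !mxE.
apply: eq_bigr => q _; rewrite linear_sum summxE; apply: eq_bigr => p _.
by rewrite linearZ /= gring_row_regular !mxE.
Qed.

(** Quasi-idempotence moves the trace from the Specht module to the whole regular representation,
    where it is a sum over conjugates. *)
Lemma specht_char_formula c :
    (forall g, \sum_h young_coef h * young_coef (h^-1 * g)%g = c * young_coef g) ->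
  forall g, c * specht_char F la g = \sum_h young_coef (h * g^-1 * h^-1)%g.
Proof.
move=> ee g; rewrite -mxtrace_lmul_regular.
have eqU : (lmul_mx young_coef :=: specht_module F k la)%MS.
  by rewrite /specht_module gring_row_young; apply: cyclic_mx_lmul.
exact: (mxtrace_submod_quasi_idempotent _ eqU (lmul_mx_sqr ee) (in_setT g)).
Qed.

Lemma specht_charJ (g h : 'S_k) : specht_char F la (g ^ h)%g = specht_char F la g.
Proof.
rewrite /specht_char conjgE repr_mxM ?inE // [LHS]mxtrace_mulC.
by rewrite -repr_mxM ?inE // mulgK.
Qed.

(** The immanant is the trace on the Specht module of the sum of all [s] weighted by
    [\prod_i Y i (s i)]. Multiplying this sum by the symmetrizer produces, for each row permutation,
    a signed column sum as in the hypothesis. *)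
Lemma immanant_eq0 (Y : 'M[F]_k) :
    (forall y z : 'S_k,
      \sum_(q in C) (-1) ^+ q * \prod_i Y (y i) (z ((q^-1)%g i)) = 0) ->
  immanant la Y = 0.
Proof.
move=> Y0; rewrite /immanant.
pose w (s : 'S_k) : F := \prod_i Y i (s i).
transitivity (\sum_(s in [set: 'S_k]%G) w s * specht_char F la s).
  by apply: eq_big => [s|s _]; rewrite ?inE // mulrC.
apply: mxtrace_submod_sum_eq0.
set W := \sum_(x in _) _.
have [M ->] : exists M, specht_module F k la = M *m lmul_mx young_coef.
  apply/submxP; rewrite /specht_module gring_row_young cyclic_mx_lmul //.
suff LW : lmul_mx young_coef *m W = 0 by rewrite -mulmxA LW mulmx0.
apply/row_matrixP => i; rewrite row_mul row0.
have -> : row i (lmul_mx young_coef) = row_of_fun (fun y => young_coef (y * (enum_val i)^-1)%g).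
  by apply/rowP => j; rewrite !mxE.
rewrite mulmx_sumr; apply/rowP => j; rewrite summxE mxE.
under eq_bigr => s _ do rewrite -scalemxAr row_of_funJ !mxE /young_coef.
move: (enum_val i) (enum_val j) => x z.
under eq_bigr => s _ do rewrite mulr_sumr.
rewrite exchange_big /=.
under eq_bigr => q _ do under eq_bigr => s _ do rewrite mulr_sumr.
under eq_bigr => q _ do rewrite exchange_big /=.
rewrite exchange_big /= big1 // => p _.
transitivity (\sum_(q in C) (-1) ^+ q * \prod_i Y ((p * x)%g i) (z ((q^-1)%g i))); last exact: Y0.
apply: eq_bigr => q _.
(* For fixed [q] and [p], only this [s] solves [q * p = z * s^-1 * x^-1]. *)
rewrite (bigD1 (x^-1 * p^-1 * q^-1 * z)%g) ?inE //= big1 ?addr0 => [|s /andP[_ ns]].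
  rewrite !invMg !mulgA.
  have -> : (q * p == z * z^-1 * q^-1^-1 * p^-1^-1 * x^-1^-1 * x^-1)%g.
    by rewrite !invgK mulgV mul1g mulgK.
  rewrite mulr1 mulrC; congr (_ * _).
  rewrite /w (reindex_inj (@perm_inj _ (p * x)%g)) /=; apply: eq_bigr => t _.
  by rewrite -!mulgA !permM !permK.
case: eqP => [e|_]; last by rewrite !mulr0.
have zE : z = (q * p * x * s)%g by rewrite e !mulgKV.
by case/eqP: ns; rewrite zE !mulgA !mulgKV mulVg mul1g.
Qed.
End SpechtTrace.

(** * Shapes with at least three rows *)

Section LongColumn.
Variables (F : numFieldType) (k : nat) (la : seq nat).
Local Notation C := (col_stabilizer k la).

Lemma tperm_col_stabilizer (i j : 'I_k) :
  reshape_offset la i = reshape_offset la j -> tperm i j \in C.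
Proof.
by move=> eij; rewrite inE; apply/forallP => l; case: tpermP => [->|->|]; rewrite ?eij.
Qed.

Lemma col_stabilizerMr (q t : 'S_k) : t \in C -> ((q * t)%g \in C) = (q \in C).
Proof.
rewrite !inE => /forallP tC; apply/forallP/forallP => qC l.
  by rewrite -(eqP (qC l)) permM eq_sym.
by rewrite permM (eqP (tC _)).
Qed.

Lemma sum_col_prod_eq0 (f g : 'I_k -> F) (i j l : 'I_k) :
    i != j -> i != l -> j != l ->
    reshape_offset la i = reshape_offset la j ->
    reshape_offset la i = reshape_offset la l ->
  \sum_(q in C) (-1) ^+ q * \prod_t (f t - g ((q^-1)%g t)) = 0.
Proof.
move=> nij nil njl oij oil.
under eq_bigr => q _ do rewrite bigA_distr mulr_sumr.
rewrite exchange_big /= big1 // => J _.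
(* Pigeonhole: two of [i], [j], [l] agree on membership in [J]. *)
have [x [y [nxy xyC xyJ]]] :
    exists x y, [/\ x != y, tperm x y \in C & (x \in J) = (y \in J)].
  have ojl : reshape_offset la j = reshape_offset la l by rewrite -oij.
  case ei: (i \in J); case ej: (j \in J); case el: (l \in J);
    solve [ by exists i, j; rewrite ei ej nij tperm_col_stabilizer
          | by exists i, l; rewrite ei el nil tperm_col_stabilizer
          | by exists j, l; rewrite ej el njl tperm_col_stabilizer ].
set S := (X in X = _); suff SN : S = - S.
  by apply/eqP; rewrite -[_ == 0](mulrn_eq0 _ 2) mulr2n {2}SN subrr.
rewrite {1}/S (reindex_inj (mulIg (tperm x y))) /= -sumrN.
apply: eq_big => [q|q _]; first by rewrite col_stabilizerMr.
rewrite odd_permM odd_tperm nxy addbT signrN mulNr; congr (- (_ * _)).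
have JE t : (tperm x y t \in J) = (t \in J) by case: tpermP => [->|->|].
(* Factors in [J] do not involve [q]; the transposition preserves the complement of [J] and only
   reorders the factors there. *)
rewrite (bigID (mem J)) [RHS](bigID (mem J)) /=; congr (_ * _).
  by apply: eq_bigr => t ->.
rewrite [LHS](reindex_inj (@perm_inj _ (tperm x y))) /=.
apply: eq_big => [t|t]; rewrite JE // => /negPf->.
by rewrite invMg permM tpermV tpermK.
Qed.
End LongColumn.

Lemma immanant_delta_minus_long (F : numFieldType) k (la : seq nat) (X : 'M[F]_k) :
  is_partition_of k la -> (2 < size la)%N -> immanant la (delta_minus X) = 0.
Proof.
case/and3P=> _ la0 /eqP sla sz; apply: immanant_eq0 => y z.
(* The parts are positive, so rows 0, 1 and 2 each have a first box, and these three lie in column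
   0. *)
have pos r : (r < 3)%N -> (0 < nth 0 la r)%N.
  move=> r3; rewrite lt0n; apply: contraNneq la0 => <-.
  by rewrite mem_nth // (leq_trans r3).
have lt r : (r < 3)%N -> (flatten_index la r 0 < k)%N.
  by move=> r3; rewrite -sla flatten_indexP // pos.
have rE r (r3 : (r < 3)%N) : reshape_index la (Ordinal (lt r r3)) = r.
  by rewrite /= flatten_indexKl // pos.
have oE r (r3 : (r < 3)%N) : reshape_offset la (Ordinal (lt r r3)) = 0%N.
  by rewrite /= flatten_indexKr // pos.
under eq_bigr => q _ do under eq_bigr => t _ do rewrite mxE.
apply: (@sum_col_prod_eq0 F k la (fun i => X (y i) (y i)) (fun i => X (z i) (z i))
  (Ordinal (lt 0%N isT)) (Ordinal (lt 1%N isT)) (Ordinal (lt 2%N isT)));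
  rewrite ?oE //; apply/eqP => e;
  by have := congr1 (fun i : 'I_k => reshape_index la i) e; rewrite !rE.
Qed.

(** * Shapes with at most two rows *)

Section TwoRows.
Variables (F : numFieldType) (k : nat) (la : seq nat) (a m : nat).
Hypotheses (le_ma : (m <= a)%N) (def_k : k = (a + m)%N).
Hypothesis rowE : forall i : 'I_k, reshape_index la i = (a <= i)%N.
Hypothesis colE : forall i : 'I_k,
  reshape_offset la i = (if i < a then i : nat else i - a)%N.

Local Notation C := (col_stabilizer k la).
Local Notation R := (row_stabilizer k la).
Local Notation eps := (young_coef F (k := k) la).
Implicit Types (A B S T U V : {set 'I_k}) (x y z : 'I_k) (p q g h : 'S_k).

Lemma row_stabilizerP p : reflect (forall x, (p x < a) = (x < a))%N (p \in R).
Proof.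
rewrite inE; apply: (iffP forallP) => rp x; have := rp x; rewrite !rowE.
  by rewrite [in LHS]ltnNge [in RHS]ltnNge; case: (a <= p x)%N; case: (a <= x)%N.
by rewrite !(leqNgt a) => ->.
Qed.

Lemma col_stabilizerP q :
  reflect (forall x, (if q x < a then q x : nat else q x - a) =
                     (if x < a then x : nat else x - a))%N (q \in C).
Proof.
rewrite inE; apply: (iffP forallP) => rp x; have := rp x; rewrite !colE.
  by move/eqP.
by move->.
Qed.

Lemma row_stabilizer_group_set : group_set R.
Proof.
apply/group_setP; split=> [|p1 p2 /row_stabilizerP h1 /row_stabilizerP h2].
  by apply/row_stabilizerP => x; rewrite perm1.
by apply/row_stabilizerP => x; rewrite permM h2 h1.
Qed.
Canonical row_stabilizer_group := Group row_stabilizer_group_set.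

Lemma col_stabilizer_group_set : group_set C.
Proof.
apply/group_setP; split=> [|p1 p2 /col_stabilizerP h1 /col_stabilizerP h2].
  by apply/col_stabilizerP => x; rewrite perm1.
by apply/col_stabilizerP => x; rewrite permM h2 h1.
Qed.
Canonical col_stabilizer_group := Group col_stabilizer_group_set.

Lemma tperm_column x y : y = (a + x)%N :> nat -> tperm x y \in C.
Proof.
move=> yx; apply/col_stabilizerP => z.
have := ltn_ord y; have := ltn_ord x.
case: tpermP => [->|->|//]; rewrite yx; do 2 case: ifP; lia.
Qed.

Lemma tperm_row x y : (x < a)%N -> (y < a)%N -> tperm x y \in R.
Proof.
by move=> xa ya; apply/row_stabilizerP => z; case: tpermP => [->|->|]; rewrite ?xa ?ya.
Qed.

Lemma col_fix q x : q \in C -> (m <= x < a)%N -> q x = x.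
Proof.
move=> /col_stabilizerP/(_ x) e /andP[mx xa]; apply/val_inj => /=.
by move: e (ltn_ord (q x)); rewrite xa; case: ifP; lia.
Qed.

(** The first row is fixed box by box, so a box of the second row cannot move up: the place above it
    is taken. *)
Lemma col_stabilizer_trivial q :
  q \in C -> (forall x, (x < m)%N -> (q x < a)%N) -> q = 1%g.
Proof.
move=> qC qm; have lt x : (x < a)%N -> q x = x.
  move=> xa; case: (ltnP x m) => [xm|mx]; last by rewrite (col_fix qC) // mx.
  by apply/val_inj; have /col_stabilizerP/(_ x) := qC; rewrite xa qm.
apply/permP => x; rewrite perm1; case: (ltnP x a) => [|ax]; first exact: lt.
have xk := ltn_ord x.
have x'k : (x - a < k)%N by lia.
pose x' := Ordinal x'k.
have qx' : q x' = x' by apply: lt => /=; lia.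
apply/val_inj => /=; have /col_stabilizerP/(_ x) := qC.
have -> : (x < a)%N = false by lia.
case: ifP => qa e; last by lia.
have /perm_inj e' : q x = q x' by rewrite qx'; apply/val_inj.
by have /= := congr1 val e'; lia.
Qed.

(* The columns of length 2 are the pairs [x], [a + x] with [x < m]; those of
   length 1 are the [x] with [m <= x < a]. *)
Definition column_alternating (psi : {set 'I_k} -> F) : Prop :=
  (forall x y T, y = (a + x)%N :> nat -> psi (tperm x y @: T) = - psi T) /\
  (forall x y T, (m <= x < a)%N -> (m <= y < a)%N -> psi (tperm x y @: T) = psi T).

Definition col_transversal T : bool :=
  [forall x : 'I_k, forall y : 'I_k, (y == a + x :> nat)%N ==> ((x \in T) != (y \in T))].

Lemma col_transversalP T :
  reflect (forall x y, y = (a + x)%N :> nat -> (y \in T) = (x \notin T)) (col_transversal T).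
Proof.
apply: (iffP forallP) => [tT x y e|tT x].
  by have /forallP/(_ y) := tT x; rewrite e eqxx /=; case: (x \in T); case: (y \in T).
apply/forallP => y; apply/implyP => /eqP/tT->.
by case: (x \in T).
Qed.

Lemma column_alternating_eq0 psi T :
  column_alternating psi -> ~~ col_transversal T -> psi T = 0.
Proof.
move=> [alt _] /forallPn[x /forallPn[y]]; rewrite negb_imply negbK => /andP[/eqP yx /eqP e].
have := alt x y T yx; have -> : tperm x y @: T = T.
  by apply/setP => z; rewrite in_imset_tperm; case: tpermP => [->|->|].
by move=> eN; apply/eqP; rewrite -[_ == 0](mulrn_eq0 _ 2) mulr2n {2}eN subrr.
Qed.

(** Exchange the two boxes of a column of length two where [A] and [B] differ, at the cost of a
    sign. Once these columns agree, the remaining differences lie in columns of length one, where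
    exchanges preserve [psi]. *)
Lemma column_alternating_uniq psi A B :
    column_alternating psi -> col_transversal B -> psi B = 0 -> #|A| = #|B| ->
  psi A = 0.
Proof.
move=> altpsi trB psiB0; apply: (swap_ind (P := fun A => psi A = 0)) => // {}A cAB nAB.
have [x xAB] := eq_card_setDn0 cAB nAB.
have [y yBA] : exists y, y \in B :\: A by apply: eq_card_setDn0; rewrite 1?eq_sym.
have [trA|ntrA] := boolP (col_transversal A); last first.
  by exists x, y; split=> // _; apply: column_alternating_eq0.
have [[u [v [vu neq]]]|agree] :
   (exists u v : 'I_k, v = (a + u)%N :> nat /\ (u \in A) <> (u \in B)) \/
   (forall u v : 'I_k, v = (a + u)%N :> nat -> (u \in A) = (u \in B)).
- have [/existsP[u /existsP[v /andP[/eqP vu /eqP n]]]|/existsPn h] :=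
    boolP [exists u : 'I_k, exists v : 'I_k, (v == a + u :> nat)%N && ((u \in A) != (u \in B))].
    by left; exists u, v.
  right=> u v vu; have /existsPn/(_ v) := h u.
  by rewrite vu eqxx negbK => /eqP.
- have vA := col_transversalP _ trA _ _ vu; have vB := col_transversalP _ trB _ _ vu.
  have psi0 : psi (tperm u v @: A) = 0 -> psi A = 0.
    by rewrite (altpsi.1 _ _ _ vu) => /eqP; rewrite oppr_eq0 => /eqP.
  case uA: (u \in A) neq vA; case uB: (u \in B) vB => //= vB _ vA.
    by exists u, v; rewrite !inE uA uB vA vB.
  by exists v, u; rewrite !inE uA uB vA vB tpermC.
(* [agree] concerns upper boxes; transversality of [A] and [B] transfers it to lower ones. *)
have single z : (z \in A) != (z \in B) -> (m <= z < a)%N.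
  move=> nz; have zk := ltn_ord z; apply: contraTT nz; rewrite negb_and -!ltnNge.
  case/orP=> hz; rewrite negbK; apply/eqP.
    have azk : (a + z < k)%N by lia.
    exact: (agree _ (Ordinal azk)).
  have zak : (z - a < k)%N by lia.
  have e : z = (a + Ordinal zak)%N :> nat by rewrite /=; lia.
  by rewrite (col_transversalP _ trA _ _ e) (col_transversalP _ trB _ _ e) (agree _ _ e).
exists x, y; split => //; rewrite altpsi.2 //; apply: single.
  by move: xAB; rewrite inE; case: (x \in A); case: (x \in B).
by move: yBA; rewrite inE; case: (y \in A); case: (y \in B).
Qed.

(* Matrix of the Young symmetrizer acting on the span of the subsets. *)
Definition young_op T U : F :=
  \sum_(q in C) \sum_(p in R) (-1) ^+ q * ((q * p)%g @: T == U)%:R.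

Lemma young_opE T U : young_op T U = \sum_g eps g * (g @: T == U)%:R.
Proof.
rewrite /young_op /young_coef; under [RHS]eq_bigr => g _ do rewrite mulr_suml.
rewrite [RHS]exchange_big /=; apply: eq_bigr => q _.
under [RHS]eq_bigr => g _ do rewrite mulr_suml.
rewrite [RHS]exchange_big /=; apply: eq_bigr => p _.
rewrite (bigD1 (q * p)%g) //= eqxx mulr1 big1 ?addr0 // => g.
by rewrite eq_sym => /negPf->; rewrite mulr0 mul0r.
Qed.

(** A transposition inside a column is absorbed into [C] and changes the sign. One between columns
    of length one commutes with [C], whose elements fix both boxes, and is absorbed into [R]. *)
Lemma young_op_alternating U : column_alternating (young_op^~ U).
Proof.
split=> [x y T yx|x y T /andP[mx xa] /andP[my ya]]; rewrite /young_op.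
  have tC := tperm_column yx.
  rewrite (reindex_inj (mulgI (tperm x y))) /= -sumrN.
  apply: eq_big => [q|q _]; first by rewrite groupMl.
  rewrite -sumrN; apply: eq_bigr => p _.
  rewrite odd_permM odd_tperm -imset_permM !mulgA tperm2 mul1g.
  have -> : x != y by apply/eqP => e; have := ltn_ord y; move: yx; rewrite e; lia.
  by rewrite addTb signrN mulNr.
have zR := tperm_row xa ya.
apply: eq_bigr => q qC; rewrite (reindex_inj (mulgI (tperm x y))) /=.
have tq : (tperm x y * q = q * tperm x y)%g.
  by rewrite conjgC tpermJ !(col_fix qC) ?mx ?my.
apply: eq_big => [p|p _]; first by rewrite groupMl.
by rewrite -imset_permM mulgA tq -mulgA (mulgA (tperm x y)) tperm2 mul1g.
Qed.

(** The 2 by 2 minor, as a function of [T], is column alternating and vanishes at [T'], hence at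
    every set of that size. *)
Lemma young_op_rank1 T T' U U' : #|T| = #|T'| ->
  young_op T U * young_op T' U' = young_op T' U * young_op T U'.
Proof.
move=> cTT'; have [trT'|ntr] := boolP (col_transversal T'); last first.
  rewrite (column_alternating_eq0 (young_op_alternating U') ntr).
  by rewrite (column_alternating_eq0 (young_op_alternating U) ntr) mulr0 mul0r.
pose psi V := young_op V U * young_op T' U' - young_op T' U * young_op V U'.
apply/eqP; rewrite -subr_eq0 -/(psi T); apply/eqP.
apply: (@column_alternating_uniq psi T T') => //; last by rewrite /psi subrr.
have [o1 o2] := young_op_alternating U; have [o1' o2'] := young_op_alternating U'.
split=> [x y V yx|x y V hx hy]; rewrite /psi.
  by rewrite o1 // o1' // mulNr mulrN -opprB opprK addrC.
by rewrite o2 // o2'.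
Qed.

Definition young_trace (l : nat) : F := \sum_(T : {set 'I_k} | #|T| == l) young_op T T.

(** A matrix [M] of rank at most one satisfies [M *m M = \tr M *: M]. *)
Lemma young_op_sqr S U :
  \sum_h eps h * young_op (h @: S) U = young_trace #|S| * young_op S U.
Proof.
rewrite /young_trace mulr_suml.
under [RHS]eq_bigr => V /eqP cV do rewrite (young_op_rank1 _ _ cV) young_opE mulr_suml.
rewrite exchange_big /=; apply: eq_bigr => h _.
rewrite (bigD1 (h @: S)) ?card_imset_perm //= eqxx mulr1 big1 ?addr0 // => V /andP[_].
by rewrite eq_sym => /negPf->; rewrite mulr0 mul0r.
Qed.

Lemma young_coefMr g p : p \in R -> eps (g * p)%g = eps g.
Proof.
move=> pR; apply: eq_bigr => q _; rewrite (reindex_inj (mulIg p)) /=.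
apply: eq_big => [p'|p' _]; first by rewrite groupMr.
by rewrite mulgA (inj_eq (mulIg p)).
Qed.

Definition second_row : {set 'I_k} := [set x : 'I_k | (a <= x)%N].

Lemma row_stabilizer_second_row p : (p \in R) = (p @: second_row == second_row).
Proof.
apply/row_stabilizerP/eqP => [rp|e x].
  apply/setP => x; rewrite in_imset_perm !inE !(leqNgt a); congr (~~ _).
  by rewrite -rp permKV.
have : (p x \in p @: second_row) = (p x \in second_row) by rewrite e.
by rewrite in_imset_perm permK !inE !(leqNgt a) => /negb_inj ->.
Qed.

(** The permutations that count here form the coset of [g] modulo [R], on which [eps] is constant.
    This reads [eps] off the action on subsets. *)
Lemma young_op_second_row g :
  young_op ((g^-1)%g @: second_row) second_row = #|R|%:R * eps g.
Proof.
rewrite young_opE (reindex_inj (mulgI g)) /=.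
rewrite (eq_bigr (fun p => if p \in R then eps g else 0)) => [|p _].
  by rewrite -big_mkcond sumr_const mulr_natl.
rewrite -imset_permM mulKg -row_stabilizer_second_row.
by case: ifP => pR; rewrite ?mulr0 // young_coefMr // mulr1.
Qed.

(* The coefficients are right invariant under [R], hence functions of the
   preimage of the second row; there [young_op] has rank one. *)
Lemma young_coef_sqr g :
  \sum_h eps h * eps (h^-1 * g)%g = young_trace #|second_row| * eps g.
Proof.
have nzR : (#|R|%:R : F) != 0 by rewrite pnatr_eq0 -lt0n cardG_gt0.
apply: (mulfI nzR); rewrite mulrCA -young_op_second_row.
have := young_op_sqr ((g^-1)%g @: second_row) second_row.
rewrite card_imset_perm => <-; rewrite mulr_sumr; apply: eq_bigr => h _.
by rewrite mulrCA -young_op_second_row -imset_permM invMg invgK.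
Qed.

(** If [q * p = 1], then [q] preserves the rows as well as the columns, so it is trivial. *)
Lemma young_coef1 : eps 1%g = 1.
Proof.
rewrite /young_coef (bigD1 1%g) ?group1 //= [X in _ + X]big1 ?addr0 => [|q /andP[qC nq]].
  rewrite odd_perm1 (bigD1 1%g) ?group1 //= mul1g eqxx big1 ?addr0 ?mul1r // => p.
  by case/andP=> _ /negPf np; rewrite mul1g np mulr0.
rewrite big1 // => p pR; case: eqP => [e|_]; last by rewrite mulr0.
case/eqP: nq; apply: col_stabilizer_trivial => // x xm.
have /row_stabilizerP <- := pR; rewrite -permM e perm1.
exact: leq_trans xm le_ma.
Qed.

(** Both traces are the constant in the quasi-idempotence of one element: one from its action on
    [l]-subsets, the other from [young_coef_sqr]. A nonzero entry of the action identifies them. *)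
Lemma young_traceE l : (m <= l <= a)%N -> young_trace l = young_trace #|second_row|.
Proof.
case/andP=> ml la'; pose S := [set x : 'I_k | (x < l)%N].
have cS : #|S| = l.
  have lk : (l <= k)%N by lia.
  have winj : injective (widen_ord lk) by move=> i j /(congr1 val) /= /val_inj.
  rewrite -[RHS]card_ord -(card_imset _ winj).
  apply: eq_card => x; rewrite inE; apply/idP/imsetP => [xl|[y _ ->] //=].
  by exists (Ordinal xl) => //; apply/val_inj.
(* Since [m <= l <= a], only [q = 1] can contribute, and all its terms are nonnegative, with 1
   coming from [p = 1]. *)
have nz : young_op S S != 0.
  rewrite /young_op (bigD1 1%g) ?group1 //= [X in _ + X]big1 ?addr0 => [|q /andP[qC nq]].
    rewrite odd_perm1 (bigD1 1%g) ?group1 //= mul1g imset_perm1 eqxx mul1r.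
    under eq_bigr => p _ do rewrite mul1r.
    by rewrite -natr_sum nat1r pnatr_eq0.
  rewrite big1 // => p pR; case: eqP => [e|_]; last by rewrite mulr0.
  case/eqP: nq; apply: col_stabilizer_trivial => // x xm.
  have /row_stabilizerP <- := pR; rewrite -permM.
  have : (q * p)%g x \in S by rewrite -e imset_f // inE; lia.
  by rewrite inE; lia.
apply: (mulIf nz); rewrite -{1}cS -young_op_sqr.
rewrite (young_opE S) mulr_sumr.
under [RHS]eq_bigr => g _ do rewrite mulrA -young_coef_sqr mulr_suml.
rewrite [RHS]exchange_big /=; apply: eq_bigr => h _.
rewrite [RHS](reindex_inj (mulgI h)) young_opE mulr_sumr /=; apply: eq_bigr => g _.
by rewrite mulKg -imset_permM mulrA.
Qed.

Lemma col_transversal_card_ge T : col_transversal T -> (m <= #|T|)%N.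
Proof.
move=> /col_transversalP trT.
have upP (i : 'I_m) : (i < k)%N by have := ltn_ord i; lia.
have loP (i : 'I_m) : (a + i < k)%N by have := ltn_ord i; lia.
(* [f] picks the box of [T] in each column of length two. *)
pose f (i : 'I_m) := if Ordinal (upP i) \in T then Ordinal (upP i) else Ordinal (loP i).
have f_inj : injective f.
  move=> i j e; apply/val_inj; have := congr1 val e; rewrite /f.
  by have := ltn_ord i; have := ltn_ord j; do 2 case: ifP => _ /=; lia.
rewrite -[X in (X <= _)%N]card_ord -(card_imset _ f_inj); apply: subset_leq_card.
apply/subsetP => x /imsetP[i _ ->]; rewrite /f; case: ifP => // nT.
by rewrite (trT (Ordinal (upP i))) ?nT.
Qed.

Lemma col_transversalC T : col_transversal T -> col_transversal (~: T).
Proof.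
by move=> /col_transversalP trT; apply/col_transversalP => x y /trT e; rewrite !inE e.
Qed.

Lemma col_transversal_card_le T : col_transversal T -> (#|T| <= a)%N.
Proof.
move=> /col_transversalC/col_transversal_card_ge; rewrite cardsCs setCK card_ord.
by have := max_card_ord T; lia.
Qed.

Lemma young_trace0 l : ~~ (m <= l <= a)%N -> young_trace l = 0.
Proof.
move=> nl; rewrite /young_trace big1 // => T /eqP cT.
apply: (column_alternating_eq0 (young_op_alternating T)).
apply: contra nl => trT; rewrite -cT col_transversal_card_ge //=.
exact: col_transversal_card_le.
Qed.

Lemma fixed_sets_signV g : fixed_sets_sign F (g^-1)%g = fixed_sets_sign F g.
Proof.
apply: eq_bigl => T; apply/eqP/eqP => {1}<-.
  by rewrite -imset_permM mulVg imset_perm1.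
by rewrite -imset_permM mulgV imset_perm1.
Qed.

Lemma fixed_sets_signJ g h : fixed_sets_sign F (g ^ h)%g = fixed_sets_sign F g.
Proof.
rewrite /fixed_sets_sign (reindex_inj (imset_inj (@perm_inj _ h))) /=.
apply: eq_big => [T|T _]; last by rewrite card_imset_perm.
rewrite -imset_permM conjgE mulKVg imset_permM.
by rewrite (inj_eq (imset_inj (@perm_inj _ h))).
Qed.

Lemma sum_young_fixed_sets :
  \sum_g eps g * fixed_sets_sign F g =
  young_trace #|second_row| * \sum_(l < k.+1 | (m <= l <= a)%N) (-1) ^+ l.
Proof.
transitivity (\sum_(T : {set 'I_k}) (-1) ^+ #|T| * young_op T T).
  under [RHS]eq_bigr => T _ do rewrite young_opE mulr_sumr.
  rewrite [RHS]exchange_big /=; apply: eq_bigr => g _.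
  rewrite /fixed_sets_sign mulr_sumr [LHS]big_mkcond; apply: eq_bigr => T _.
  by case: ifP => _; rewrite ?mulr0 // mulr1 mulrC.
rewrite big_set_card mulr_sumr [RHS]big_mkcond /=; apply: eq_bigr => l _.
rewrite (eq_bigr (fun T => (-1) ^+ l * young_op T T)) => [|T /eqP-> //].
rewrite -mulr_sumr -/(young_trace l); case: ifP => [ml|/negbT ml].
  by rewrite young_traceE // mulrC.
by rewrite young_trace0 // mulr0.
Qed.

(** [fixed_sets_sign] is invariant under conjugation and inversion, so each of the [k!] conjugates
    in the character formula contributes [sum_young_fixed_sets]. *)
Lemma sum_specht_fixed_sets :
  \sum_(g : 'S_k) specht_char F la g * fixed_sets_sign F g =
  k`!%:R * \sum_(l < k.+1 | (m <= l <= a)%N) (-1) ^+ l.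
Proof.
set c := young_trace #|second_row|.
have chiE := specht_char_formula young_coef_sqr.
(* At the identity the character formula equates a multiple of [c] with [k!]. *)
have nzc : c != 0.
  have := chiE 1%g; under eq_bigr => h _ do rewrite invg1 mulg1 mulgV young_coef1.
  rewrite sumr_const card_Sn -/c => e; apply/eqP => c0; move: e.
  by rewrite c0 mul0r => /esym/eqP; rewrite pnatr_eq0 -[_ == _]negbK -lt0n fact_gt0.
apply: (mulfI nzc); rewrite mulr_sumr.
under eq_bigr => g _ do rewrite mulrA chiE mulr_suml.
rewrite exchange_big /= mulrCA -sum_young_fixed_sets mulr_natl -card_Sn -sumr_const.
apply: eq_bigr => h _.
rewrite [RHS](reindex_inj (inj_comp (@conjg_inj _ (h^-1)%g) (@invg_inj _))) /=.
apply: eq_bigr => g _; rewrite fixed_sets_signJ fixed_sets_signV; congr (eps _ * _).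
by rewrite conjgE invgK mulgA.
Qed.
End TwoRows.

(** * Sign sums and comparison with the permanent *)

Lemma sum_fixed_sets (F : numFieldType) k :
  \sum_(g : 'S_k) fixed_sets_sign F g = k`!%:R * \sum_(l < k.+1) (-1) ^+ l.
Proof.
transitivity (\sum_(T : {set 'I_k}) (-1) ^+ #|T| * ((k - #|T|)`! * #|T|`!)%:R : F).
  under eq_bigr => g _ do rewrite /fixed_sets_sign big_mkcond /=.
  rewrite exchange_big /=; apply: eq_bigr => T _.
  have := sum_perm_imset T T; rewrite eqxx mul1n => <-.
  rewrite natr_sum mulr_sumr; apply: eq_bigr => g _.
  by case: ifP => _; rewrite ?mulr1 ?mulr0.
rewrite big_set_card mulr_sumr; apply: eq_bigr => l _.
rewrite (eq_bigr (fun=> (-1) ^+ l * ((k - l)`! * l`!)%:R)) => [|T /eqP-> //].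
rewrite sumr_const -[LHS]mulr_natr -mulrA -natrM mulrC; congr (_%:R * _).
(* The ['C(k, l)] subsets of size [l] have weight [(k - l)! * l!] each, so every [l] contributes
   [k!] up to sign. *)
rewrite -(bin_fact (leq_ord l)) [LHS]mulnC [X in (_ * X = _)%N]mulnC; congr (_ * _)%N.
rewrite -[X in 'C(X, _)](card_ord k) -card_draws.
by apply: eq_card => T; rewrite !inE.
Qed.

(** For odd [k] both sums vanish. For even [k] the interval has odd length [a - m + 1], so its sum
    is its first sign, and the full sum is 1. *)
Lemma sum_sign_interval (F : numFieldType) k a m : k = (a + m)%N -> (m <= a)%N ->
  \sum_(l < k.+1 | (m <= l <= a)%N) (-1) ^+ l =
    (-1) ^+ m * \sum_(l < k.+1) (-1) ^+ l :> F.
Proof.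
move=> kE ma.
have A n : \sum_(l < n) (-1) ^+ l = (odd n)%:R :> F.
  elim: n => [|n IH]; first by rewrite big_ord0.
  by rewrite big_ord_recr /= IH -signr_odd; case: (odd n); rewrite ?expr1 ?addrN ?add0r.
have e : \sum_(l < m) (-1) ^+ l + \sum_(l < k.+1 | (m <= l <= a)%N) (-1) ^+ l
   = \sum_(l < a.+1) (-1) ^+ l :> F.
  rewrite -!(big_mkord xpredT (fun l => (-1) ^+ l)) (@big_cat_nat _ _ _ m 0 a.+1) //=; last by lia.
  congr (_ + _); rewrite -(big_mkord (fun l => (m <= l <= a)%N) (fun l => (-1) ^+ l)).
  rewrite (@big_cat_nat _ _ _ m 0 k.+1) //=; last by lia.
  rewrite big_nat_cond big1 ?add0r => [|i /andP[hi1 hi2]]; last by lia.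
  rewrite (@big_cat_nat _ _ _ a.+1 m k.+1) //=; [|by lia|by lia].
  rewrite addrC big_nat_cond big1 ?add0r => [|i /andP[hi1 hi2]]; last by lia.
  by rewrite big_nat_cond [RHS]big_nat_cond; apply: eq_bigl => i; lia.
move: e; rewrite !A kE /= -signr_odd oddD.
move=> /(canRL (addKr _)) ->.
by case: (odd m); case: (odd a); rewrite /= ?expr1 ?expr0; 
  rewrite ?mulN1r ?mul1r ?oppr0 ?add0r ?addNr ?addr0.
Qed.

Lemma two_row_shape k la : is_partition_of k la -> (size la <= 2)%N ->
  let a := nth 0%N la 0 in let m := nth 0%N la 1 in
  [/\ (m <= a)%N, k = (a + m)%N,
      forall i : 'I_k, reshape_index la i = (a <= i)%N
    & forall i : 'I_k, reshape_offset la i = (if i < a then i : nat else i - a)%N].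
Proof.
case/and3P=> srt la0 /eqP sla sz; case: la srt la0 sla sz => [|a [|m [|]]] //=.
- by move=> _ _ <- _; split=> // -[].
- rewrite addn0 => _ _ <- _; rewrite ?addn0; split=> // i.
    by have ia := ltn_ord i; rewrite /reshape_index /= subn_eq0 ia; lia.
  by have ia := ltn_ord i; rewrite /reshape_offset /reshape_index /= subn_eq0 ia /= subn0.
rewrite addn0 andbT => ma _ <- _; split=> // i; have ik := ltn_ord i.
  by rewrite /reshape_index /= !subn_eq0 leq_subLR ik; case: ltnP.
rewrite /reshape_offset /reshape_index /= !subn_eq0 leq_subLR ik.
by case: ltnP => /= _; rewrite ?subn0 ?addn0.
Qed.

Lemma immanant_delta_minus_two_rows (F : numFieldType) k la (X : 'M[F]_k) :
    is_partition_of k la -> (size la <= 2)%N ->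
  immanant la (delta_minus X) =
    (-1) ^+ nth 0%N la 1 * \sum_(s : 'S_k) \prod_(i < k) (X i i - X (s i) (s i)).
Proof.
move=> pla sz; have [ma kE rowE colE] := two_row_shape pla sz.
set m := nth 0%N la 1 in ma kE *.
(* The class function to kill is the character minus [(-1) ^+ m] times the trivial one, whose
   immanant is the permanent. *)
have f0 : \sum_(s : 'S_k) (specht_char F la s - (-1) ^+ m) * fixed_sets_sign F s = 0.
  under eq_bigr => s _ do rewrite mulrBl.
  rewrite sumrB -mulr_sumr (sum_specht_fixed_sets _ ma kE rowE colE) sum_fixed_sets.
  by rewrite (sum_sign_interval _ kE ma) mulrCA subrr.
have fJ (s t : 'S_k) :
    specht_char F la (s ^ t)%g - (-1) ^+ m = specht_char F la s - (-1) ^+ m.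
  by rewrite specht_charJ.
have := class_function_immanant_eq0 fJ f0.
move/(congr1 (meval (fun i => X i i))); rewrite raddf_sum raddf0 /=.
under eq_bigr => s _ do rewrite mevalZ mulrBl.
rewrite sumrB -mulr_sumr => /eqP; rewrite subr_eq0 => /eqP e.
have wE (s : 'S_k) : (delta_prod F s).@[fun i => X i i] = \prod_i (X i i - X (s i) (s i)).
  by rewrite rmorph_prod; apply: eq_bigr => i _; rewrite /= mevalB !mevalXU.
rewrite -(eq_bigr _ (fun s _ => wE s)) -e /immanant.
apply: eq_bigr => s _; rewrite wE; congr (_ * _).
by apply: eq_bigr => i _; rewrite mxE.
Qed.

Theorem theorem3p3 (R : realType) (k : nat) (hk : (1 <= k)%N)
    (x : 'rV[R[i]]_k) (la : seq nat) (hla : is_partition_of k la) :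
  let X : 'M[R[i]]_k := diag_mx x in
  immanant la (delta_minus X) =
    if (size la <= 2)%N then
      (-1) ^+ nth 0%N la 1 *
        \sum_(0 <= l < k.+1)
          (-1) ^+ l * ((k - l)`!)%:R * (l`!)%:R
            * elem_sym (k - l) X * elem_sym l X
    else 0.
Proof.
move=> X; case: leqP => sz; last exact: immanant_delta_minus_long.
rewrite immanant_delta_minus_two_rows // (permanent_delta (fun i => X i i)).
have eE l : sum_sym (fun i => X i i) l = elem_sym l X.
  rewrite /elem_sym /mesym raddf_sum; apply: eq_bigr => A _ /=.
  by rewrite rmorph_prod; apply: eq_bigr => i _; rewrite /= mevalXU.
by congr (_ * _); apply: eq_bigr => l _; rewrite !eE.
Qed.
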